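(* Let $Z$ and $Z^{(n)}$, $n\in\mathbb{N}$, be random vectors in $\mathbb{R}^d$ whose components are nonnegative and integrable, with max-characteristic functions $\varphi_Z$ and $\varphi_{Z^{(n)}}$, $n\in\mathbb{N}$. Then $\varphi_{Z^{(n)}}\to\varphi_Z$ pointwise as $n\to\infty$ if and only if $d_W(Z^{(n)},Z)\to 0$ as $n\to\infty$.
   Context: For a random vector $Z=(Z_1,\dots,Z_d)$ in $\mathbb{R}^d$ with nonnegative integrable components, its max-characteristic function is the function $\varphi_Z:[0,\infty)^d\to\mathbb{R}$, $\varphi_Z(x)=\mathrm{E}\{\max(1,x_1Z_1,\dots,x_dZ_d)\}$. For two probability distributions $P,Q$ on $\mathbb{R}^d$ with finite first moments, the Wasserstein metric is $d_W(P,Q)=\inf\{\mathrm{E}(\|X-Y\|_1): X \text{ has distribution } P,\ Y\text{ has distribution } Q\}$, where $\|x\|_1=\sum_{i=1}^d|x_i|$ and the infimum is over all couplings. For integrable random vectors $X,Y$ with distributions $P,Q$ one writes $d_W(X,Y)=d_W(P,Q)$. *)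

(* Defs.v *)
From HB Require Import structures.
From mathcomp Require Import all_boot all_order all_algebra.
From mathcomp Require Import all_classical all_reals all_analysis.

Set Implicit Arguments.
Unset Strict Implicit.
Unset Printing Implicit Defensive.

Import Order.TTheory GRing.Theory Num.Theory.
Import numFieldNormedType.Exports.

Local Open Scope classical_set_scope.
Local Open Scope ring_scope.

(* R^d is [d.-tuple R], whose sigma-algebra is generated by the coordinate
   projections. *)

(* Nonnegativity is almost sure, so that this is a property of the law of Z. *)
Definition nonneg_integrable (R : realType) (d : nat) (disp : measure_display)
    (T : measurableType disp) (P : probability T R)
    (Z : {RV P >-> d.-tuple R}) : Prop :=
  forall i : 'I_d,
    {ae P, forall w, 0 <= tnth (Z w) i} /\
    P.-integrable setT (fun w => (tnth (Z w) i)%:E).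

Definition max_cf (R : realType) (d : nat) (disp : measure_display)
    (T : measurableType disp) (P : probability T R)
    (Z : {RV P >-> d.-tuple R}) (x : d.-tuple R) : R :=
  fine 'E_P[fun w => (\big[Num.max/1]_(i < d) (tnth x i * tnth (Z w) i))%R]%E.

Definition l1norm (R : realType) (d : nat) (x : 'I_d -> R) : R :=
  \sum_(i < d) `|x i|.

(* Laws are compared on measurable sets only: a measure is a function on all
   sets, with unconstrained values outside the sigma-algebra. *)
Definition has_law (R : realType) (d : nat) (disp : measure_display)
    (T : measurableType disp) (P : probability T R)
    (X : {RV P >-> d.-tuple R}) (mu : probability (d.-tuple R) R) : Prop :=
  forall A : set (d.-tuple R), measurable A -> distribution P X A = mu A.

(* The infimum is over all pairs (X, Y) defined on a common, arbitrary
   probability space. It is taken in \bar R; it is finite when mu and nu have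
   finite first moments. *)
Definition wasserstein (R : realType) (d : nat)
    (mu nu : probability (d.-tuple R) R) : \bar R :=
  ereal_inf [set e : \bar R |
    exists (disp : measure_display) (T : measurableType disp)
      (P : probability T R) (X Y : {RV P >-> d.-tuple R}),
      [/\ has_law X mu, has_law Y nu &
          e = 'E_P[fun w => l1norm (fun i => (tnth (X w) i - tnth (Y w) i)%R)]%E]].

(* Main.v *)
Require Import Defs.
From HB Require Import structures.
From mathcomp Require Import all_boot all_order all_algebra.
From mathcomp Require Import all_classical all_reals all_analysis.
From mathcomp Require Import measurable_realfun.
From mathcomp Require Import ring lra.

Set Implicit Arguments.
Unset Strict Implicit.
Unset Printing Implicit Defensive.

Import Order.TTheory GRing.Theory Num.Theory.
Import numFieldNormedType.Exports.

Local Open Scope classical_set_scope.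
Local Open Scope ring_scope.

(** Write V_x(z) = max(1, x_1 z_1, ..., x_d z_d), so that the
    max-characteristic function is x |-> E V_x(Z).

    If the laws are close in the Wasserstein metric, the values E V_x are close
    because V_x is Lipschitz for the l1 norm: see [max_cf_lipschitz].

    Conversely, suppose that E V_x(Z^(n)) -> E V_x(Z) for every x >= 0.  Replacing
    negative coordinates by 0 changes neither V_x nor the laws, so all vectors
    may be taken nonnegative everywhere.  Homogeneity gives
    E max(t, M_n) -> E max(t, M) for all t > 0, where M is any maximum of
    coordinates with nonnegative weights.  The function t |-> E max(t, M) is
    convex, and its slopes are squeezed between values of the distribution
    function of M; hence P(M_n <= t) -> P(M <= t) whenever P(M = t) = 0
    ([cvg_cdf_of_mean_max]).  The event M <= t is an orthant, that is, a finite
    intersection of events Z_i <= y, and inclusion-exclusion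
    ([cvg_sign_patterns]) turns convergence for orthants into convergence of
    the probability of each cell of a finite grid whose hyperplanes carry no
    mass.

    A coupling is then built by hand.  Label a point by its grid cell.  As soon
    as the n-th cell probabilities are at least lam times the limit ones, some
    coupling gives both points the same label with probability at least lam
    ([label_coupling]).  Two nonnegative numbers in the same cell differ by at
    most the mesh s plus their excesses over the top level K of the grid, and in
    any case by at most K plus these excesses.  The expected excess
    E max(K, Z_i) - K of Z^(n) converges to that of Z, which is small for
    large K.  Choosing in turn s, then K, then lam makes the transport cost
    arbitrarily small. *)

(** * Couplings of finitely labelled probability spaces *)

Section finite_labels.
Context d (T : measurableType d) (R : realType) (P : probability T R).

Lemma probability_fineK (A : set T) : measurable A -> (fine (P A))%:E = P A.
Proof. by move=> mA; rewrite fineK// fin_num_measure. Qed.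

Lemma probability_fibers (I : finType) (b : T -> I) (A : set T) :
    (forall k, measurable (b @^-1` [set k])) -> measurable A ->
  P A = (\sum_k P (A `&` b @^-1` [set k]))%E.
Proof.
move=> mb mA.
have {1}-> : A = \bigcup_k (A `&` b @^-1` [set k]).
  apply/seteqP; split=> [x Ax|x [k _ []]//].
  by exists (b x).
have triv : trivIset setT (fun k => A `&` b @^-1` [set k]).
  apply/trivIsetP => i j _ _ ij; apply/seteqP; split=> // x [[_ /= bi] [_ bj]].
  by move: ij; rewrite -bi -bj eqxx.
rewrite (measure_fin_bigcup _ finite_finset triv) => [|k _]; last first.
  exact: measurableI.
rewrite [setT](_ : _ = [set` index_enum I]).
  by rewrite -fsbig_seq// index_enum_uniq.
by apply/seteqP; split=> // k _ /=; rewrite mem_index_enum.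
Qed.

End finite_labels.

Lemma measurable_label_neq d1 d2 (T1 : measurableType d1)
    (T2 : measurableType d2) (I : finType) (b1 : T1 -> I) (b2 : T2 -> I) :
    (forall k, measurable (b1 @^-1` [set k])) ->
    (forall k, measurable (b2 @^-1` [set k])) ->
  measurable [set x : T1 * T2 | b1 x.1 <> b2 x.2].
Proof.
move=> mb1 mb2; rewrite [X in measurable X](_ : _ =
    ~` \bigcup_k (b1 @^-1` [set k] `*` b2 @^-1` [set k])).
  apply: measurableC; apply: fin_bigcup_measurable => // j _.
  exact: measurableX.
apply/seteqP; split=> [x neq [j _ [/= b1k b2k]]|x nU /= b12].
  by apply: neq; rewrite b1k b2k.
by apply: nU; exists (b1 x.1).
Qed.

(** The coupling below has a density which is constant on products of label
    classes; this produces measures of that form. *)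
Lemma weighted_restriction_measure d (T : measurableType d) (R : realType)
    (mu : {measure set T -> \bar R}) (I : finType) (c : I -> R)
    (D : I -> set T) :
    (forall i, 0 <= c i) -> (forall i, measurable (D i)) ->
  exists m : {measure set T -> \bar R},
    forall A, m A = (\sum_i (c i)%:E * mu (A `&` D i))%E.
Proof.
move=> c0 mD.
pose piece i : {measure set T -> \bar R} :=
  mscale (NngNum (c0 i)) (mrestr mu (mD i)).
pose s := [seq piece i | i <- enum I].
pose z : {measure set T -> \bar R} := mzero.
exists (msum (nth z s) (size s)) => A.
rewrite [LHS](_ : _ = \sum_(k < size s) nth z s k A)%E//.
rewrite -(big_mkord xpredT (fun k => nth z s k A)).
rewrite -(big_nth z xpredT (fun m : {measure set T -> \bar R} => m A)).
by rewrite big_map big_enum.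
Qed.

Section label_coupling.
Context d1 d2 (T1 : measurableType d1) (T2 : measurableType d2) (R : realType).
Variables (P1 : probability T1 R) (P2 : probability T2 R) (I : finType).
Variables (b1 : T1 -> I) (b2 : T2 -> I) (lam : R).
Hypothesis mb1 : forall k, measurable (b1 @^-1` [set k]).
Hypothesis mb2 : forall k, measurable (b2 @^-1` [set k]).
Hypothesis lam0 : 0 < lam.
Hypothesis dom : forall k,
  (lam%:E * P2 (b2 @^-1` [set k]) <= P1 (b1 @^-1` [set k]))%E.

(** With Q the product of P1 and P2, p_k = P1(b1 = k) and q_k = P2(b2 = k), the
    coupling has density
      lam / p_k * 1(b2 = k) + (1 - lam * q_k / p_k)    on  b1 = k
    with respect to Q.  Integrating out the second variable gives 1; integrating
    out the first gives lam + (1 - lam) = 1; and the labels can differ only in the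
    second term, whose mass is the sum of the p_k - lam * q_k. *)
Lemma label_coupling : exists pi : probability (T1 * T2)%type R,
  [/\ forall A, measurable A -> pi (fst @^-1` A) = P1 A,
      forall B, measurable B -> pi (snd @^-1` B) = P2 B &
      (pi [set w | b1 w.1 <> b2 w.2] <= (1 - lam)%:E)%E].
Proof.
pose B1 k := b1 @^-1` [set k]; pose B2 k := b2 @^-1` [set k].
have mB1 k : measurable (B1 k) by exact: mb1.
have mB2 k : measurable (B2 k) by exact: mb2.
pose p k := fine (P1 (B1 k)); pose q k := fine (P2 (B2 k)).
have pE k : P1 (B1 k) = (p k)%:E by rewrite -probability_fineK.
have qE k : P2 (B2 k) = (q k)%:E by rewrite -probability_fineK.
have p0 k : 0 <= p k by apply: fine_ge0; exact: measure_ge0.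
have q0 k : 0 <= q k by apply: fine_ge0; exact: measure_ge0.
have lamqp k : lam * q k <= p k.
  by have := dom k; rewrite -/(B1 k) -/(B2 k) pE qE -EFinM lee_fin.
(* Classes with p_k = 0 get weight c k = 0, because the inverse of 0 is 0; they
   are harmless since q_k = 0 there. *)
have q_eq0 k : p k = 0 -> q k = 0.
  move=> pk0; apply/eqP; rewrite eq_le q0 andbT -(pmulr_rle0 _ lam0) -pk0.
  exact: lamqp.
have sum_q : \sum_k q k = 1.
  apply: EFin_inj; rewrite -(probability_setT P2) (probability_fibers P2 mb2)//.
  by rewrite -sumEFin; apply: eq_bigr => k _; rewrite setTI -qE.
have sum_p : \sum_k p k = 1.
  apply: EFin_inj; rewrite -(probability_setT P1) (probability_fibers P1 mb1)//.
  by rewrite -sumEFin; apply: eq_bigr => k _; rewrite setTI -pE.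
pose c k := lam / p k; pose e k := 1 - lam * q k / p k.
have c0 k : 0 <= c k by rewrite divr_ge0// ltW.
have e0 k : 0 <= e k.
  rewrite subr_ge0; have [->|pk0] := eqVneq (p k) 0; first by rewrite invr0 mulr0.
  by rewrite ler_pdivrMr ?mul1r// lt_neqAle eq_sym pk0/=.
have ep k : e k * p k = p k - lam * q k.
  have [pk0|pk0] := eqVneq (p k) 0; last by rewrite /e; field.
  by rewrite pk0 q_eq0// !mulr0 subr0.
have ceq k : c k * q k + e k = 1 by rewrite /c /e; ring.
pose D (i : I + I) := match i with
  | inl k => B1 k `*` B2 k | inr k => B1 k `*` [set: T2] end.
pose w (i : I + I) := match i with inl k => c k | inr k => e k end.
have w0 i : 0 <= w i by case: i.
have mD i : measurable (D i) by case: i => k; exact: measurableX.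
have [m mE] := weighted_restriction_measure (P1 \x P2)%E w0 mD.
have mX (A : set T1) (B : set T2) : measurable A -> measurable B ->
    m (A `*` B) = (\sum_k ((c k)%:E * (P1 (A `&` B1 k) * P2 (B `&` B2 k)) +
                     (e k)%:E * (P1 (A `&` B1 k) * P2 B)))%E.
  move=> mA mB; rewrite mE big_sumType/= -big_split/=; apply: eq_bigr => k _.
  by rewrite -!setXI setIT !product_measure1E//; exact: measurableI.
have m1 A : measurable A -> m (A `*` setT) = P1 A.
  move=> mA; rewrite mX// (probability_fibers P1 mb1 mA); apply: eq_bigr => k _.
  rewrite setTI qE probability_setT mule1.
  rewrite -(probability_fineK P1 (measurableI _ _ mA (mB1 k))) -!EFinM -EFinD.
  by congr (_%:E); rewrite -[RHS]mul1r -(ceq k); ring.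
have m2 B : measurable B -> m (setT `*` B) = P2 B.
  move=> mB; rewrite mX//.
  pose r k := fine (P2 (B `&` B2 k)).
  have rE k : P2 (B `&` B2 k) = (r k)%:E.
    by rewrite -probability_fineK//; exact: measurableI.
  have rq k : r k <= q k.
    by rewrite -lee_fin -rE -qE le_measure// ?inE//; exact: measurableI.
  have r0 k : 0 <= r k by apply: fine_ge0; exact: measure_ge0.
  have r_eq0 k : p k = 0 -> r k = 0.
    by move=> pk0; apply/eqP; rewrite eq_le r0 andbT (le_trans (rq k))// q_eq0.
  have sum_r : \sum_k r k = fine (P2 B).
    apply: EFin_inj; rewrite probability_fineK// (probability_fibers P2 mb2 mB).
    by rewrite -sumEFin; apply: eq_bigr => k _; rewrite -rE.
  under eq_bigr => k _ do rewrite setTI pE rE -(probability_fineK P2 mB)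
    -!EFinM -EFinD [(e k * _)%R]mulrA ep.
  rewrite sumEFin -(probability_fineK P2 mB); congr (_%:E).
  rewrite (eq_bigr (fun k => lam * r k + (p k - lam * q k) * fine (P2 B))).
    rewrite big_split/= -mulr_sumr -mulr_suml sumrB -mulr_sumr sum_p sum_q sum_r.
    by ring.
  move=> k _; congr (_ + _); rewrite /c.
  by have [pk0|pk0] := eqVneq (p k) 0; [rewrite r_eq0// !mulr0|field].
have mT : m setT = 1%E by rewrite -setXTT m1// probability_setT.
(* m has mass 1 already; normalizing only provides the probability structure. *)
pose pi : probability (T1 * T2)%type R := mnormalize m (P1 \x P2)%E.
have piE A : pi A = m A.
  by rewrite /= /mnormalize mT onee_eq0/= invr1 mule1.
exists pi; split.
- by move=> A mA; rewrite piE -m1//; congr (m _); apply/seteqP; split=> [x|x []].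
- by move=> B mB; rewrite piE -m2//; congr (m _); apply/seteqP; split=> [x|x []].
rewrite piE mE big_sumType/= big1 ?add0e; last first.
  move=> k _; rewrite (_ : _ `&` _ = set0) ?measure0 ?mule0//.
  by apply/seteqP; split=> // x [/= neq [/= b1k b2k]]; case: neq; rewrite b1k b2k.
have -> : ((1 - lam)%:E = \sum_k (e k * p k)%:E)%E.
  rewrite sumEFin; congr (_%:E); under eq_bigr do rewrite ep.
  by rewrite sumrB -mulr_sumr sum_p sum_q mulr1.
apply: lee_sum => k _; rewrite EFinM lee_wpmul2l ?lee_fin//.
rewrite -pE -[leRHS]mule1 -(probability_setT P2) -product_measure1E//.
have mneq := measurable_label_neq mb1 mb2.
by apply: le_measure => //; rewrite ?inE; [apply: measurableI => // |];
  exact: measurableX.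
Qed.

End label_coupling.

(** * Convergence of distribution functions *)

Section sign_patterns.
Context (R : realType) d (T : measurableType d) (P : probability T R).
Context (dn : nat -> measure_display) (Tn : forall n, measurableType (dn n)).
Variable Pn : forall n, probability (Tn n) R.
Context (J : Type) (A : J -> set T) (An : forall n, J -> set (Tn n)).
Arguments An : clear implicits.
Hypothesis mA : forall j, measurable (A j).
Hypothesis mAn : forall n j, measurable (An n j).

(** Inclusion-exclusion, one event at a time:
    P(S and not F) = P(S) - P(S and F). *)
Lemma cvg_sign_patterns :
    (forall s : seq J, fine (Pn n (\big[setI/setT]_(j <- s) An n j))
       @[n --> \oo] --> fine (P (\big[setI/setT]_(j <- s) A j))) ->
  forall s t : seq J,
    fine (Pn n (\big[setI/setT]_(j <- s) An n j `&`
                \big[setI/setT]_(j <- t) ~` An n j)) @[n --> \oo] -->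
    fine (P (\big[setI/setT]_(j <- s) A j `&`
             \big[setI/setT]_(j <- t) ~` A j)).
Proof.
move=> cvgA s t; elim: t s => [|j t IHt] s.
  rewrite big_nil setIT; apply: cvg_trans (cvgA s); apply: near_eq_cvg.
  by near=> n; rewrite big_nil setIT.
have fineD d' (T' : measurableType d') (P' : probability T' R) (F : J -> set T') :
    (forall j, measurable (F j)) ->
    fine (P' (\big[setI/setT]_(j <- s) F j `&`
              \big[setI/setT]_(j <- j :: t) ~` F j)) =
    fine (P' (\big[setI/setT]_(j <- s) F j `&`
              \big[setI/setT]_(j <- t) ~` F j)) -
    fine (P' (\big[setI/setT]_(j <- j :: s) F j `&`
              \big[setI/setT]_(j <- t) ~` F j)).
  move=> mF; rewrite !big_cons.
  set S := \big[_/_]_(_ <- s) _; set C := \big[_/_]_(_ <- t) _.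
  have mS : measurable S by exact: bigsetI_measurable.
  have mC : measurable C.
    by apply: bigsetI_measurable => i _; exact: measurableC.
  have -> : S `&` (~` F j `&` C) = (S `&` C) `\` (F j `&` S `&` C).
    apply/seteqP; split=> [x [Sx [nFx Cx]]|x [[Sx Cx] nFSC]].
      by split=> // -[[]].
    by split=> //; split=> // Fx; apply: nFSC.
  have mFSC : measurable (F j `&` S `&` C).
    by apply: measurableI => //; exact: measurableI.
  have mSC : measurable (S `&` C) by exact: measurableI.
  have finSC : (P' (S `&` C) < +oo)%E by rewrite -ge0_fin_numE// fin_num_measure.
  have mI : measurable (S `&` C `&` (F j `&` S `&` C)) by exact: measurableI.
  rewrite measureD// fineB ?fin_num_measure//.
  by congr (_ - fine (P' _)); apply/seteqP; split=> [x []|x [[]]].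
rewrite fineD//; under eq_fun do rewrite fineD//.
by apply: cvgB; exact: IHt.
Unshelve. all: by end_near. Qed.

End sign_patterns.

Section call_prices.
Context (R : realType).

Lemma measurable_sublevel d (T : measurableType d) (M : T -> R) (t : R) :
  measurable_fun setT M -> measurable [set w | M w <= t].
Proof.
move=> mM; rewrite -[X in measurable X]setTI.
exact: (measurable_fun_le measurableT mM (measurable_cst _)).
Qed.

Lemma measurable_strict_sublevel d (T : measurableType d) (M : T -> R) (t : R) :
  measurable_fun setT M -> measurable [set w | M w < t].
Proof.
move=> mM; rewrite (_ : [set w | _] = ~` [set w | - M w <= - t]).
  by apply: measurableC; apply: measurable_sublevel; exact: measurable_funN.
by apply/seteqP; split=> w /=; rewrite lerN2 ltNge => /negP.
Qed.

Lemma measurable_level d (T : measurableType d) (M : T -> R) (t : R) :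
  measurable_fun setT M -> measurable [set w | M w = t].
Proof.
move=> mM; rewrite (_ : [set w | _] = [set w | M w <= t] `\` [set w | M w < t]).
  apply: measurableD; first exact: measurable_sublevel.
  exact: measurable_strict_sublevel.
apply/seteqP; split=> w /=; first by move=> ->; rewrite lexx ltxx.
by move=> -[Mt /negP]; rewrite -leNgt => tM; apply/eqP; rewrite eq_le Mt.
Qed.

(** Right continuity of the distribution function of M. *)
Lemma near_right_sublevel d (T : measurableType d) (P : probability T R)
    (M : T -> R) (t e : R) : measurable_fun setT M -> 0 < e ->
  \forall v \near t^'+,
    fine (P [set w | M w <= v]) < fine (P [set w | M w <= t]) + e.
Proof.
move=> mM e0.
pose X : {RV P >-> R} := HB.pack M (isMeasurableFun.Build _ _ _ _ M mM).
have cdfE v : P [set w | M w <= v] = cdf X v.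
  by congr (P _); apply/seteqP; split=> w /=; rewrite in_itv.
have : fine (cdf X v) @[v --> t^'+] --> fine (cdf X t).
  apply: fine_cvg; rewrite fineK; first exact: cdf_right_continuous.
  by rewrite -cdfE fin_num_measure//; exact: measurable_sublevel.
move=> /cvgrPdist_lt /(_ _ e0); apply: filterS => v.
by rewrite distrC !cdfE => /ltr_distlDr.
Qed.

Lemma integrable_maxr d (T : measurableType d)
    (mu : {measure set T -> \bar R}) (f g : T -> R) :
    mu.-integrable setT (EFin \o f) -> mu.-integrable setT (EFin \o g) ->
  mu.-integrable setT (fun w => (Num.max (f w) (g w))%:E).
Proof.
move=> intf intg.
apply: le_integrable (integrableD measurableT (integrable_norm intf)
  (integrable_norm intg)) => //.
  apply/measurable_EFinP; apply: measurable_maxr; apply/measurable_EFinP.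
    exact: measurable_int intf.
  exact: measurable_int intg.
move=> w _; rewrite /= lee_fin.
rewrite [leRHS]ger0_norm ?addr_ge0//.
by rewrite maxEle; case: ifP => _; rewrite ?lerDr ?lerDl.
Qed.

Lemma integrable_max_cst d (T : measurableType d) (P : probability T R)
    (M : T -> R) (t : R) : P.-integrable setT (EFin \o M) ->
  P.-integrable setT (fun w => (Num.max t (M w))%:E).
Proof.
by apply: integrable_maxr; exact: finite_measure_integrable_cst.
Qed.

Lemma integrable_bigmaxr d (T : measurableType d) (P : probability T R)
    (I : Type) (s : seq I) (a : R) (f : I -> T -> R) :
    (forall i, P.-integrable setT (EFin \o f i)) ->
  P.-integrable setT (EFin \o (fun w => \big[Num.max/a]_(i <- s) f i w)).
Proof.
move=> intf; elim: s => [|i s IHs].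
  under eq_fun do rewrite big_nil.
  exact: finite_measure_integrable_cst.
under eq_fun do rewrite big_cons.
exact: (integrable_maxr (intf i) IHs).
Qed.

(** In the variable t, a convex function which is an antiderivative of the
    distribution function of M. *)
Definition mean_max d (T : measurableType d) (P : probability T R)
    (M : T -> R) (t : R) : R := \int[P]_w Num.max t (M w).

(** On M <= u the increment max(v, M) - max(u, M) equals v - u, on M >= v it
    vanishes, and in between it lies between 0 and v - u. *)
Lemma mean_max_slope d (T : measurableType d) (P : probability T R)
    (M : T -> R) (u v : R) : P.-integrable setT (EFin \o M) -> u <= v ->
  (v - u) * fine (P [set w | M w <= u]) <= mean_max P M v - mean_max P M u /\
  mean_max P M v - mean_max P M u <= (v - u) * fine (P [set w | M w < v]).
Proof.
move=> iM uv; have mM : measurable_fun setT M.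
  by apply/measurable_EFinP; exact: measurable_int iM.
rewrite /mean_max -RintegralB//; [|exact: integrable_max_cst..].
have iB : P.-integrable setT
    (EFin \o (fun w => Num.max v (M w) - Num.max u (M w))).
  have := integrableB measurableT (integrable_max_cst v iM)
    (integrable_max_cst u iM).
  by apply: eq_integrable.
have indE (A : set T) : measurable A ->
    (v - u) * fine (P A) = \int[P]_w ((v - u) * \1_A w).
  move=> mA; rewrite RintegralZl//; last first.
    exact: integrable_indic.
  by rewrite /Rintegral integral_indic// setIT.
have iI (A : set T) : measurable A ->
    P.-integrable setT (EFin \o (fun w => (v - u) * \1_A w)).
  by move=> mA; exact: (integrableZl measurableT (v - u) (integrable_indic P mA)).
have mle : measurable [set w | M w <= u] by exact: measurable_sublevel.
have mlt : measurable [set w | M w < v] by exact: measurable_strict_sublevel.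
rewrite !indE//; split; apply: le_Rintegral => //; try exact: iI.
- move=> w _; rewrite indicE; have [|] := boolP (w \in _).
    rewrite inE/= mulr1 => Mu.
    by rewrite (max_idPl (le_trans Mu uv)) (max_idPl Mu).
  by rewrite mulr0 subr_ge0 ge_max !le_max uv !lexx orbT.
- move=> w _; rewrite indicE; have [|] := boolP (w \in _).
    rewrite inE/= mulr1 => Mv; rewrite (max_idPl (ltW Mv)) lerB//.
    by rewrite le_max lexx.
  rewrite notin_setE/= => /negP; rewrite -leNgt => vM.
  by rewrite mulr0 (max_idPr vM) (max_idPr (le_trans uv vM)) subrr.
Qed.

(** Convergence of convex functions forces convergence of their slopes; for
    u < t < v, the slopes on [u, t] and on [t, v] bracket P(M_n <= t) and, in the
    limit, lie within [P(M <= u), P(M <= v)]. *)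
Lemma cvg_cdf_of_mean_max d (T : measurableType d) (P : probability T R)
    (dn : nat -> measure_display) (Tn : forall n, measurableType (dn n))
    (Pn : forall n, probability (Tn n) R)
    (M : T -> R) (Mn : forall n, Tn n -> R) (t : R) :
    P.-integrable setT (EFin \o M) ->
    (forall n, (Pn n).-integrable setT (EFin \o Mn n)) ->
    (forall u, 0 < u ->
       mean_max (Pn n) (@Mn n) u @[n --> \oo] --> mean_max P M u) ->
    0 < t -> P [set w | M w = t] = 0%E ->
  fine (Pn n [set w | Mn n w <= t]) @[n --> \oo] --> fine (P [set w | M w <= t]).
Proof.
move=> iM iMn cvgG t0 Pt.
have mM : measurable_fun setT M.
  by apply/measurable_EFinP; exact: measurable_int iM.
have mMn n : measurable_fun setT (@Mn n).
  by apply/measurable_EFinP; exact: measurable_int (iMn n).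
have mle := measurable_sublevel _ mM; have mlt := measurable_strict_sublevel _ mM.
have mneq := measurable_level t mM.
have PltE : P [set w | M w < t] = P [set w | M w <= t].
  rewrite (_ : [set w | M w <= t] = [set w | M w < t] `|` [set w | M w = t]).
    by rewrite measureU0.
  apply/seteqP; split=> w /=; first by rewrite le_eqVlt => /predU1P[|]; tauto.
  by case=> [/ltW//|->].
apply/cvgrPdist_lt => e e0; have e20 : 0 < e / 2 by rewrite divr_gt0.
have [v tv Pv] : exists2 v, t < v &
    fine (P [set w | M w <= v]) < fine (P [set w | M w <= t]) + e / 2.
  near (t^'+) => v; exists v => //.
  by near: v; exact: near_right_sublevel.
(* Left continuity of P(M <= .) at t, available because M has no atom there, is
   right continuity for - M. *)
have [u /andP[u0 ut] Pu] : exists2 u, 0 < u < t &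
    fine (P [set w | M w <= t]) - e / 2 < fine (P [set w | M w <= u]).
  have mN : measurable_fun setT (fun w => - M w) by exact: measurable_funN.
  have NE r : fine (P [set w | - M w <= r]) = 1 - fine (P [set w | M w < - r]).
    rewrite (_ : [set w | - M w <= r] = ~` [set w | M w < - r]).
      rewrite probability_setC// fineB ?fin_num_measure//.
    by apply/seteqP; split=> w /=; rewrite lerNl leNgt => /negP.
  near ((- t)^'+) => r.
  have Pr : fine (P [set w | - M w <= r]) <
            fine (P [set w | - M w <= - t]) + e / 2.
    by near: r; exact: near_right_sublevel.
  exists (- r).
    rewrite oppr_gt0 ltrNl; apply/andP; split=> //.
    near: r; apply: nbhs_right_lt; by rewrite oppr_lt0.
  move: Pr; rewrite !NE opprK PltE => Pr.
  have : fine (P [set w | M w < - r]) <= fine (P [set w | M w <= - r]).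
    rewrite fine_le ?fin_num_measure// le_measure ?inE//.
    by move=> w /ltW.
  by lra.
have slope (a b : R) : 0 < a -> a < b ->
    (mean_max (Pn n) (@Mn n) b - mean_max (Pn n) (@Mn n) a) / (b - a)
    @[n --> \oo] --> (mean_max P M b - mean_max P M a) / (b - a).
  move=> a0 ab; apply: cvgMl; apply: cvgB; apply: cvgG => //.
  exact: lt_trans ab.
near=> n.
have up : fine (Pn n [set w | Mn n w <= t]) <= 
  (mean_max (Pn n) (@Mn n) v - mean_max (Pn n) (@Mn n) t) / (v - t).
  rewrite ler_pdivlMr ?subr_gt0// mulrC.
  by have [] := mean_max_slope (iMn n) (ltW tv).
have up' : (mean_max P M v - mean_max P M t) / (v - t) <= fine (P [set w | M w <= v]).
  rewrite ler_pdivrMr ?subr_gt0// mulrC.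
  have [_ /le_trans] := mean_max_slope iM (ltW tv); apply.
  rewrite ler_pM2l ?subr_gt0// fine_le ?fin_num_measure// le_measure ?inE//.
  by move=> w /ltW.
have lo : (mean_max (Pn n) (@Mn n) t - mean_max (Pn n) (@Mn n) u) / (t - u) <=
    fine (Pn n [set w | Mn n w <= t]).
  rewrite ler_pdivrMr ?subr_gt0// mulrC.
  have [_ /le_trans] := mean_max_slope (iMn n) (ltW ut); apply.
  rewrite ler_pM2l ?subr_gt0// fine_le ?fin_num_measure//.
  - exact: measurable_strict_sublevel.
  - exact: measurable_sublevel.
  rewrite le_measure ?inE//.
  - exact: measurable_strict_sublevel.
  - exact: measurable_sublevel.
  by move=> w /ltW.
have lo' : fine (P [set w | M w <= u]) <=
    (mean_max P M t - mean_max P M u) / (t - u).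
  rewrite ler_pdivlMr ?subr_gt0// mulrC.
  by have [] := mean_max_slope iM (ltW ut).
have : `|(mean_max P M v - mean_max P M t) / (v - t) -
    (mean_max (Pn n) (@Mn n) v - mean_max (Pn n) (@Mn n) t) / (v - t)| < e / 2.
  by near: n; move/cvgrPdist_lt: (slope t v t0 tv); exact.
have : `|(mean_max P M t - mean_max P M u) / (t - u) -
    (mean_max (Pn n) (@Mn n) t - mean_max (Pn n) (@Mn n) u) / (t - u)| < e / 2.
  by near: n; move/cvgrPdist_lt: (slope u t u0 ut); exact.
rewrite !ltr_norml => /andP[lo1 lo2] /andP[up1 up2].
by apply/andP; split; lra.
Unshelve. all: by end_near. Qed.
End call_prices.

(** * Maxima of weighted coordinates *)

Section max_functionals.
Context (R : realType) (d : nat).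
Implicit Types (x z : d.-tuple R) (S : seq ('I_d * R)).

Definition linmax x z : R := \big[Num.max/0]_(i < d) (tnth x i * tnth z i).

(** The pairs in S carry a coordinate and its weight; a coordinate may be
    repeated. *)
Definition listmax S z : R :=
  \big[Num.max/0]_(j <- S) (j.2 * tnth z j.1).

(** Homogeneity, which lets the threshold 1 in a max-characteristic function be
    replaced by any t > 0. *)
Lemma max_linmaxE x z (t : R) : 0 < t ->
  Num.max t (linmax x z) =
  t * \big[Num.max/1]_(i < d) (tnth [tuple tnth x i / t | i < d] i * tnth z i).
Proof.
move=> t0; rewrite /linmax.
elim/big_rec2: _ => [|i a b _ IH]; first by rewrite mulr1 (max_idPl (ltW t0)).
rewrite tnth_mktuple maxr_pMr ?ltW// maxCA IH; congr (Num.max _ _).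
by field; rewrite gt_eqF.
Qed.

(** For a nonnegative coordinate, only the largest of its weights matters. *)
Lemma listmax_linmaxE S z : (forall i, 0 <= tnth z i) ->
  listmax S z = linmax [tuple \big[Num.max/0]_(j <- S | j.1 == i) j.2 | i < d] z.
Proof.
move=> z0; apply/eqP; rewrite eq_le; apply/andP; split.
  rewrite /listmax big_seq; apply: bigmax_le => [|j jS].
    exact: bigmax_ge_id.
  apply: le_trans (le_bigmax_cond _ _ (erefl true : xpredT j.1)).
  rewrite tnth_mktuple ler_wpM2r//.
    by apply: (bigmax_sup_seq _ j); rewrite ?eqxx.
apply: bigmax_le => [|i _]; first exact: bigmax_ge_id.
rewrite tnth_mktuple big_seq_cond.
elim/big_ind: _ => [|a b Ha Hb|j /andP[jS /eqP <-]].
- by rewrite mul0r bigmax_ge_id.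
- by rewrite maxr_pMl// ge_max Ha.
- by apply: (bigmax_sup_seq _ j).
Qed.

Lemma linmax_weight_ge0 S i :
  0 <= tnth [tuple \big[Num.max/0]_(j <- S | j.1 == i) j.2 | i < d] i.
Proof. by rewrite tnth_mktuple bigmax_ge_id. Qed.

Context disp (T : measurableType disp) (P : probability T R).
Variable Z : {RV P >-> d.-tuple R}.
Hypothesis iZ : forall i, P.-integrable setT (fun w => (tnth (Z w) i)%:E).

Lemma integrable_scaled_coord (c : R) i :
  P.-integrable setT (EFin \o (fun w => c * tnth (Z w) i)).
Proof. exact: (integrableZl measurableT c (iZ i)). Qed.

Lemma integrable_bigmax_coord (a : R) x :
  P.-integrable setT
    (EFin \o (fun w => \big[Num.max/a]_(i < d) (tnth x i * tnth (Z w) i))).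
Proof.
exact: (integrable_bigmaxr _ a (fun i => integrable_scaled_coord (tnth x i) i)).
Qed.

Lemma integrable_listmax S : P.-integrable setT (EFin \o (listmax S \o Z)).
Proof.
exact: (integrable_bigmaxr S 0 (fun j => integrable_scaled_coord j.2 j.1)).
Qed.

Lemma max_cfE x : max_cf Z x =
  \int[P]_w \big[Num.max/1]_(i < d) (tnth x i * tnth (Z w) i).
Proof. by rewrite /max_cf unlock. Qed.

Lemma mean_max_linmax x t : 0 < t ->
  mean_max P (linmax x \o Z) t = t * max_cf Z [tuple tnth x i / t | i < d].
Proof.
move=> t0; rewrite max_cfE -RintegralZl//; last exact: integrable_bigmax_coord.
by apply: eq_Rintegral => w _; exact: max_linmaxE.
Qed.

End max_functionals.

(** * Grids *)

(** Each coordinate has countably many atoms a, so the steps a / (k + 1) to be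
    avoided are countably many, whereas the interval (0, e) is not countable. *)
Lemma exists_atomless_step (R : realType) (d : nat) (disp : measure_display)
    (T : measurableType disp) (P : probability T R)
    (Z : {RV P >-> d.-tuple R}) (e : R) : 0 < e ->
  exists2 s, 0 < s < e & forall (i : 'I_d) (k : nat),
    P [set w | tnth (Z w) i = k.+1%:R * s] = 0%E.
Proof.
move=> e0.
have mZ i : measurable_fun setT (fun w => tnth (Z w) i).
  exact: (measurableT_comp (measurable_tnth i) (measurable_funPT Z)).
pose X i : {RV P >-> R} :=
  HB.pack (fun w => tnth (Z w) i) (isMeasurableFun.Build _ _ _ _ _ (mZ i)).
pose B := \bigcup_i \bigcup_k
  [set r / k.+1%:R | r in [set r | 0 < pmf (X i) r]].
have cB : countable B.
  apply: bigcup_countable => [|i _]; first exact: finite_set_countable.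
  apply: bigcup_countable => // k _.
  exact: card_le_trans (card_image_le _ _) (pmf_gt0_countable (X i)).
have [s ses nBs] : exists2 s, 0 < s < e & ~ B s.
  apply: contrapT => nex.
  have : `]0, e[ `<=` B.
    move=> s; rewrite /= in_itv/= => s0e; apply: contrapT => nBs.
    by apply: nex; exists s.
  move=> /subset_card_le /sub_countable /(_ cB) /countable_lebesgue_measure0.
  rewrite lebesgue_measure_itv/= lte_fin e0 oppr0 adde0 => -[] e_eq0.
  by move: e0; rewrite e_eq0 ltxx.
exists s => // i k.
have mlev := measurable_level (k.+1%:R * s) (mZ i).
rewrite -(probability_fineK P mlev); congr (_%:E).
apply/eqP; rewrite eq_le fine_ge0 ?andbT ?measure_ge0//.
rewrite leNgt; apply/negP => pos; apply: nBs.
exists i => //; exists k => //; exists (k.+1%:R * s) => //.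
by rewrite mulrAC mulfV ?mul1r// pnatr_eq0.
Qed.

Section grid.
Context (R : realType) (d N : nat) (s : R).

(** A cell of the grid consists of the points which lie in a prescribed
    subfamily of these half-spaces and in no other. *)
Definition halfspace (T' : Type) (Z' : T' -> d.-tuple R)
  (j : 'I_d * 'I_N) : set T' := [set w | tnth (Z' w) j.1 <= j.2.+1%:R * s].

Definition grid_weights (S : seq ('I_d * 'I_N)) : seq ('I_d * R) :=
  [seq (j.1, j.2.+1%:R^-1) | j : 'I_d * 'I_N <- S].

(** An intersection of half-spaces is an orthant, hence a sublevel set of a
    maximum of weighted coordinates. *)
Lemma bigcap_halfspace (T' : Type) (Z' : T' -> d.-tuple R)
    (S : seq ('I_d * 'I_N)) : 0 < s ->
  \big[setI/setT]_(j <- S) halfspace Z' j =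
  [set w | listmax (grid_weights S) (Z' w) <= s].
Proof.
move=> s0; elim: S => [|j S IH].
  by rewrite big_nil; apply/seteqP; split=> // w _; rewrite /listmax/= big_nil ltW.
rewrite big_cons IH; apply/seteqP.
have E w : (tnth (Z' w) j.1 <= j.2.+1%:R * s) = (j.2.+1%:R^-1 * tnth (Z' w) j.1 <= s).
  by rewrite [in RHS]mulrC ler_pdivrMr// mulrC.
split=> w; rewrite /halfspace /listmax/= big_cons/= ge_max E.
  by move=> [-> ->].
by move=> /andP[-> ->].
Qed.

Lemma measurable_halfspace disp' (T' : measurableType disp') (P' : probability T' R)
  (Z' : {RV P' >-> d.-tuple R}) j : measurable (halfspace Z' j).
Proof.
apply: measurable_sublevel.
exact: (measurableT_comp (measurable_tnth j.1) (measurable_funPT Z')).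
Qed.

Definition grid_label (z : d.-tuple R) : {ffun 'I_d * 'I_N -> bool} :=
  [ffun j : 'I_d * 'I_N => tnth z j.1 <= j.2.+1%:R * s].

Lemma grid_label_fiber (T : Type) (Z : T -> d.-tuple R)
    (f : {ffun 'I_d * 'I_N -> bool}) :
  (grid_label \o Z) @^-1` [set f] =
  \big[setI/setT]_(j <- enum [pred j | f j]) halfspace Z j `&`
  \big[setI/setT]_(j <- enum [pred j | ~~ f j]) ~` halfspace Z j.
Proof.
rewrite -!bigcap_seq; apply/seteqP; split=> [w /= <-|w [pos neg]].
  split=> j; rewrite /= mem_enum; first by rewrite !inE ffunE.
  by rewrite !inE ffunE /halfspace /= => /negP.
apply/ffunP => j; rewrite ffunE; case fj: (f j).
  by apply: pos; rewrite /= mem_enum.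
by apply/negbTE/negP; apply: neg; rewrite /= mem_enum !inE fj.
Qed.

End grid.

Arguments grid_weights {R d N} S.

Section cell_distance.
Context (R : realType) (s : R) (N : nat).
Hypothesis s0 : 0 < s.
Let K := N%:R * s.

(** If z < z' differ by more than s, the first grid level above z lies below
    z', so it separates them, unless it is beyond the last level K.  In that
    case z >= K and the distance is at most the excess of z' over K. *)
Lemma dist_le_of_same_cells (z z' : R) : 0 <= z -> 0 <= z' ->
    (forall k, (k < N)%N -> (z <= k.+1%:R * s) = (z' <= k.+1%:R * s)) ->
  `|z - z'| <= s + (Num.max K z - K) + (Num.max K z' - K).
Proof.
wlog zz' : z z' / z <= z' => [wl z_ge0 z'_ge0 same|z_ge0 z'_ge0 same].
  have [zz'|/ltW z'z] := leP z z'; first exact: wl.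
  by rewrite distrC addrAC; apply: wl => // k kN; rewrite same.
have max0 x : 0 <= Num.max K x - K by rewrite subr_ge0 le_max lexx.
rewrite distrC ger0_norm ?subr_ge0//.
have zs0 : 0 <= z / s by rewrite divr_ge0// ltW.
have := truncn_le (z / s); rewrite zs0 ler_pdivlMr//.
have := truncnS_gt (z / s); rewrite ltr_pdivrMr//.
set k := Num.truncn _ => zk kz.
have Mz' : z' <= Num.max K z' by rewrite le_max lexx orbT.
have := max0 z; have := max0 z'.
have [kN|Nk] := ltnP k N.
  have := same k kN; rewrite (ltW zk) => /esym z'k.
  have : k.+1%:R * s = k%:R * s + s by rewrite -natr1 mulrDl mul1r.
  by lra.
have : K <= z by apply: le_trans kz; rewrite ler_pM2r// ler_nat.
by lra.
Qed.

Lemma dist_le_of_nonneg (z z' : R) : 0 <= z -> 0 <= z' ->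
  `|z - z'| <= K + (Num.max K z - K) + (Num.max K z' - K).
Proof.
move=> z_ge0 z'_ge0; rewrite ler_norml.
have K0 : 0 <= K by rewrite mulr_ge0// ltW.
have : z <= Num.max K z by rewrite le_max lexx orbT.
have : z' <= Num.max K z' by rewrite le_max lexx orbT.
have : K <= Num.max K z by rewrite le_max lexx.
have : K <= Num.max K z' by rewrite le_max lexx.
by move=> *; apply/andP; split; lra.
Qed.

End cell_distance.

(** * Excess over a level *)

(** Dominated convergence: the excess of M over a level is at most M and
    vanishes once the level exceeds M. *)
Lemma cvg_excess_mean (R : realType) d (T : measurableType d)
    (P : probability T R) (M : T -> R) (s : R) : 0 < s -> (forall w, 0 <= M w) ->
    P.-integrable setT (EFin \o M) ->
  mean_max P M (N%:R * s) - N%:R * s @[N --> \oo] --> (0 : R).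
Proof.
move=> s0 M0 iM; have mM : measurable_fun setT M.
  by apply/measurable_EFinP; exact: measurable_int iM.
pose f (N : nat) w := Num.max (N%:R * s) (M w) - N%:R * s.
have mf N : measurable_fun setT (f N).
  apply: measurable_funB => //; apply: measurable_maxr => //.
have fM N w : `|f N w| <= M w.
  rewrite ger0_norm ?subr_ge0 ?le_max ?lexx// lerBlDr.
  by rewrite ge_max lerDr M0 lerDl mulr_ge0// ltW.
have E N : mean_max P M (N%:R * s) - N%:R * s = fine (\int[P]_w (f N w)%:E).
  rewrite -/(Rintegral P setT (f N)) RintegralB//; last 2 first.
  - exact: integrable_max_cst.
  - exact: finite_measure_integrable_cst.
  rewrite Rintegral_cst//; congr (_ - _); rewrite -[LHS]mulr1; congr (_ * _).
  exact: esym (congr1 fine (probability_setT P)).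
under eq_fun do rewrite E.
have -> : 0 = fine (\int[P]_w (cst 0 w : \bar R)) by rewrite integral0.
apply: fine_cvg; rewrite fineK ?integral0//.
rewrite -[X in _ --> X](integral0 P setT).
apply: (dominated_cvg _ _ _ _ iM) => //.
- by move=> N; exact/measurable_EFinP.
- move=> w _; apply: cvg_near_cst; near=> N; congr (_%:E).
  rewrite /f (max_idPl _) ?subrr//.
  rewrite -ler_pdivrMr//; near: N; exact: nbhs_infty_ger.
- by move=> N w _; rewrite lee_fin.
Unshelve. all: by end_near. Qed.

Section excess.
Context (R : realType) (d : nat).

Definition excess (K : R) (z : d.-tuple R) : R :=
  \sum_(i < d) (Num.max K (tnth z i) - K).

Lemma excess_ge0 K z : 0 <= excess K z.
Proof. by apply: sumr_ge0 => i _; rewrite subr_ge0 le_max lexx. Qed.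

Lemma measurable_excess K : measurable_fun setT (excess K).
Proof.
apply: measurable_sum => i; apply: measurable_funB => //.
by apply: measurable_maxr => //; exact: measurable_tnth.
Qed.

Lemma expected_excess (disp : measure_display) (T : measurableType disp)
    (P : probability T R) (Z : {RV P >-> d.-tuple R}) (K : R) :
    (forall i, P.-integrable setT (fun w => (tnth (Z w) i)%:E)) ->
  (\int[P]_w (excess K (Z w))%:E =
   (\sum_(i < d) (mean_max P (fun w => tnth (Z w) i) K - K))%:E)%E.
Proof.
move=> iZ.
have mZ i : measurable_fun setT (fun w => tnth (Z w) i).
  exact: (measurableT_comp (measurable_tnth i) (measurable_funPT Z)).
under eq_integral do rewrite /excess -sumEFin.
rewrite ge0_integral_sum//; last 2 first.
- move=> i; apply/measurable_EFinP; apply: measurable_funB => //.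
  exact: measurable_maxr.
- by move=> i w _; rewrite lee_fin subr_ge0 le_max lexx.
rewrite -sumEFin; apply: eq_bigr => i _.
have iM := integrable_max_cst K (iZ i).
have iK : P.-integrable setT (EFin \o cst K) by exact: finite_measure_integrable_cst.
have iB : P.-integrable setT
    (fun w => (Num.max K (tnth (Z w) i) - K)%:E) by exact: integrableB iM iK.
rewrite -[LHS]fineK; last exact: integrable_fin_num.
rewrite -/(Rintegral P setT (fun w => Num.max K (tnth (Z w) i) - K)).
congr (_%:E); rewrite RintegralB//.
rewrite (Rintegral_cst P measurableT K); congr (_ - _).
by rewrite [X in _ * X](congr1 fine (probability_setT P)) mulr1.
Qed.

End excess.

(** * From max-characteristic functions to couplings *)

(** Laws are only compared on measurable sets, which is all that integrals
    depend on. *)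
Lemma ge0_integral_law (R : realType) d1 d2 (T1 : measurableType d1)
    (T2 : measurableType d2) (mu : {measure set T1 -> \bar R})
    (nu : {measure set T2 -> \bar R}) (phi : T1 -> T2) (g : T2 -> R) :
    measurable_fun setT phi ->
    (forall A, measurable A -> mu (phi @^-1` A) = nu A) ->
    measurable_fun setT g -> (forall y, 0 <= g y) ->
  (\int[mu]_x (g (phi x))%:E = \int[nu]_y (g y)%:E)%E.
Proof.
move=> mphi law mg g0.
pose f : {mfun T1 >-> T2} := HB.pack phi (isMeasurableFun.Build _ _ _ _ _ mphi).
transitivity (\int[pushforward mu f]_y (g y)%:E)%E.
  rewrite ge0_integral_pushforward//; first exact/measurable_EFinP.
  by move=> y _; rewrite lee_fin.
by apply: eq_measure_integral => A mA _; exact: law.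
Qed.

Section convergence_of_couplings.
Context (R : realType) (d : nat).
Context (disp : measure_display) (T : measurableType disp) (P : probability T R).
Variable Z : {RV P >-> d.-tuple R}.
Context (dispn : nat -> measure_display) (Tn : forall n, measurableType (dispn n)).
Variable Pn : forall n, probability (Tn n) R.
Variable Zn : forall n, {RV (Pn n) >-> d.-tuple R}.
Hypothesis iZ : forall i, P.-integrable setT (fun w => (tnth (Z w) i)%:E).
Hypothesis iZn : forall n i,
  (Pn n).-integrable setT (fun w => (tnth (Zn n w) i)%:E).
Hypothesis Z0 : forall w i, 0 <= tnth (Z w) i.
Hypothesis Zn0 : forall n w i, 0 <= tnth (Zn n w) i.
Hypothesis cvg_phi : forall x : d.-tuple R, (forall i, 0 <= tnth x i) ->
  max_cf (Zn n) x @[n --> \oo] --> max_cf Z x.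

Lemma cvg_mean_listmax (S : seq ('I_d * R)) (t : R) : 0 < t ->
  mean_max (Pn n) (listmax S \o Zn n) t @[n --> \oo] -->
  mean_max P (listmax S \o Z) t.
Proof.
move=> t0.
pose x := [tuple \big[Num.max/0]_(j <- S | j.1 == i) j.2 | i < d].
have E disp' (T' : measurableType disp') (P' : probability T' R)
    (Z' : {RV P' >-> d.-tuple R}) : (forall w i, 0 <= tnth (Z' w) i) ->
    (forall i, P'.-integrable setT (fun w => (tnth (Z' w) i)%:E)) ->
    mean_max P' (listmax S \o Z') t = t * max_cf Z' [tuple tnth x i / t | i < d].
  move=> Z'0 iZ'; rewrite -mean_max_linmax//.
  by apply: eq_Rintegral => w _ /=; rewrite listmax_linmaxE.
rewrite E//; under eq_fun do rewrite E//.
apply: cvgMr; apply: cvg_phi => i; rewrite tnth_mktuple.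
by apply: divr_ge0; [exact: linmax_weight_ge0|exact: ltW].
Qed.

(** The boundary of an orthant is covered by grid hyperplanes. *)
Lemma negligible_listmax_level (N : nat) (s : R) (S : seq ('I_d * 'I_N)) :
    0 < s ->
    (forall (i : 'I_d) (k : nat), P [set w | tnth (Z w) i = k.+1%:R * s] = 0%E) ->
  P.-negligible [set w | listmax (grid_weights S) (Z w) = s].
Proof.
move=> s0 s_atomless; elim: S => [|j S IH].
  apply: (negligibleS _ (negligible_set0 P)) => w /=.
  by rewrite /listmax big_nil => E; move: s0; rewrite -E ltxx.
have : P.-negligible [set w | tnth (Z w) j.1 = j.2.+1%:R * s].
  apply/negligibleP; last exact: s_atomless.
  apply: measurable_level.
  exact: (measurableT_comp (measurable_tnth j.1) (measurable_funPT Z)).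
move=> /negligibleU /(_ IH); apply: negligibleS => w /=.
rewrite /listmax /= big_cons/= maxEle; case: ifP => _ E; [by right|left].
by rewrite -E mulrA mulfV ?mul1r// pnatr_eq0.
Qed.

Lemma cvg_grid_patterns (N : nat) (s : R) (S S' : seq ('I_d * 'I_N)) :
    0 < s ->
    (forall (i : 'I_d) (k : nat), P [set w | tnth (Z w) i = k.+1%:R * s] = 0%E) ->
  fine (Pn n (\big[setI/setT]_(j <- S) halfspace s (Zn n) j `&`
              \big[setI/setT]_(j <- S') ~` halfspace s (Zn n) j)) @[n --> \oo] -->
  fine (P (\big[setI/setT]_(j <- S) halfspace s Z j `&`
           \big[setI/setT]_(j <- S') ~` halfspace s Z j)).
Proof.
move=> s0 s_atomless.
apply: cvg_sign_patterns => [j|n j|{S S'} S]; [exact: measurable_halfspace..|].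
rewrite bigcap_halfspace//; under eq_fun do rewrite bigcap_halfspace//.
apply: (cvg_cdf_of_mean_max (M := listmax (grid_weights S) \o Z)
  (Mn := fun n => listmax (grid_weights S) \o Zn n)) => //.
- exact: integrable_listmax.
- by move=> n; exact: integrable_listmax.
- by move=> u u0; exact: cvg_mean_listmax.
- apply: measure_negligible; last exact: negligible_listmax_level.
  apply: measurable_level; apply/measurable_EFinP.
  exact: measurable_int (integrable_listmax iZ _).
Qed.

Lemma cvg_expected_excess (K : R) : 0 < K ->
  \sum_(i < d) (mean_max (Pn n) (fun w => tnth (Zn n w) i) K - K)
  @[n --> \oo] -->
  \sum_(i < d) (mean_max P (fun w => tnth (Z w) i) K - K).
Proof.
move=> K0; apply: cvg_big => [|i _]; first exact: add_continuous.
apply: cvgB; last exact: cvg_cst.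
have E disp' (T' : measurableType disp') (Z' : T' -> d.-tuple R) :
    (forall w i, 0 <= tnth (Z' w) i) ->
    (fun w => tnth (Z' w) i) = listmax [:: (i, 1)] \o Z'.
  move=> Z'0; apply/funext => w.
  by rewrite /listmax /= big_cons big_nil mul1r (max_idPl _).
rewrite (E _ _ _ Z0); under eq_fun do rewrite (E _ _ _ (@Zn0 _)).
exact: cvg_mean_listmax.
Qed.

(** Each of the four contributions to the cost is at most d * eta or eta: the
    mesh (d * s), the two expected excesses, and d * K times the probability
    1 - lam that the labels differ. *)
Lemma eventually_cheap_coupling (e : R) : 0 < e ->
  \forall n \near \oo, exists pi : probability (Tn n * T)%type R,
    [/\ forall A, measurable A -> pi (fst @^-1` A) = Pn n A,
        forall B, measurable B -> pi (snd @^-1` B) = P B &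
        (\int[pi]_w (l1norm (fun i =>
           (tnth (Zn n w.1) i - tnth (Z w.2) i)%R))%:E <= e%:E)%E].
Proof.
move=> e0; pose eta := e / (4 * d.+1%:R).
have eta0 : 0 < eta by rewrite divr_gt0// mulr_gt0.
have [s /andP[s0 s_eta] s_atomless] := exists_atomless_step Z eta0.
have [N N0 excessN] : exists2 N : nat, (0 < N)%N &
    \sum_(i < d) (mean_max P (fun w => tnth (Z w) i) (N%:R * s) - N%:R * s) < eta.
  have : \sum_(i < d) (mean_max P (fun w => tnth (Z w) i) (N%:R * s) - N%:R * s)
      @[N --> \oo] --> \sum_(i < d) (0 : R).
    apply: cvg_big => [|i _]; first exact: add_continuous.
    exact: (cvg_excess_mean s0 (fun w => Z0 w i) (iZ i)).
  rewrite big1// => /cvgrPdist_lt /(_ _ eta0) small.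
  near \oo => N; exists N; first by near: N; exact: nbhs_infty_gt.
  have : `|0 - \sum_(i < d) (mean_max P (fun w => tnth (Z w) i) (N%:R * s)
      - N%:R * s)| < eta by near: N.
  by rewrite sub0r normrN; apply: le_lt_trans; exact: ler_norm.
pose K := N%:R * s; have K0 : 0 < K by rewrite mulr_gt0// ltr0n.
(* So close to 1 that pairs with different labels cost at most d * eta. *)
pose lam := 1 - eta / (K + 2 * eta).
have Keta : 0 < K + 2 * eta by rewrite addr_gt0// mulr_gt0.
have lam0 : 0 < lam by rewrite subr_gt0 ltr_pdivrMr// mul1r; lra.
have lam1 : lam < 1 by rewrite ltrBlDr ltrDl divr_gt0.
have K_lam : K * (1 - lam) <= eta.
  have -> : K * (1 - lam) = (K * eta) / (K + 2 * eta) by rewrite /lam; field; lra.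
  rewrite ler_pdivrMr// mulrDr [leLHS]mulrC lerDl.
  by rewrite mulr_ge0 ?ltW// mulr_gt0.
have mfib disp' (T' : measurableType disp') (P' : probability T' R)
    (Z' : {RV P' >-> d.-tuple R}) f :
    measurable ((@grid_label R d N s \o Z') @^-1` [set f]).
  rewrite grid_label_fiber; apply: measurableI.
    by apply: bigsetI_measurable => j _; exact: measurable_halfspace.
  apply: bigsetI_measurable => j _; apply: measurableC; exact: measurable_halfspace.
have excess_near : \forall n \near \oo,
    \sum_(i < d) (mean_max (Pn n) (fun w => tnth (Zn n w) i) K - K) < eta.
  exact: (cvgr_lt _ (cvg_expected_excess K0) _ excessN).
have dom_near : \forall n \near \oo, forall f : {ffun 'I_d * 'I_N -> bool},
    (lam%:E * P ((@grid_label R d N s \o Z) @^-1` [set f]) <=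
     Pn n ((@grid_label R d N s \o Zn n) @^-1` [set f]))%E.
  apply: filter_forall => f.
  have := cvg_grid_patterns s0 s_atomless
    (S := enum [pred j | f j]) (S' := enum [pred j | ~~ f j]).
  rewrite -grid_label_fiber; under eq_fun do rewrite -grid_label_fiber.
  set p := fine (P _) => cvg_p.
  rewrite -(probability_fineK P (mfib _ _ _ Z f)) -EFinM -/p.
  (* A strict inequality in the limit is needed to get one eventually, and it fails
     exactly for null cells, where the claim is trivial. *)
  have [p0|p0] := eqVneq p 0.
    by near=> n; rewrite p0 mulr0 measure_ge0.
  have lamp : lam * p < p.
    rewrite -[ltRHS]mul1r ltr_pM2r// lt_neqAle eq_sym p0/=.
    by apply: fine_ge0; exact: measure_ge0.
  near=> n; rewrite -(probability_fineK (Pn n) (mfib _ _ _ (Zn n) f)) lee_fin.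
  by apply: ltW; near: n; exact: (cvgr_gt p).
near=> n.
have dom_n : forall f : {ffun 'I_d * 'I_N -> bool},
    (lam%:E * P ((@grid_label R d N s \o Z) @^-1` [set f]) <=
     Pn n ((@grid_label R d N s \o Zn n) @^-1` [set f]))%E by near: n.
have [pi [pi1 pi2 pi_neq]] :=
  label_coupling (mfib _ _ _ (Zn n)) (mfib _ _ _ Z) lam0 dom_n.
exists pi; split=> //.
set D := [set w | _] in pi_neq.
have mD : measurable D := measurable_label_neq (mfib _ _ _ (Zn n)) (mfib _ _ _ Z).
have excess_n : \sum_(i < d) (mean_max (Pn n) (fun w => tnth (Zn n w) i) K - K) < eta.
  by near: n.
have mZ disp' (T' : measurableType disp') (P' : probability T' R)
    (Z' : {RV P' >-> d.-tuple R}) i : measurable_fun setT (fun w => tnth (Z' w) i).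
  exact: (measurableT_comp (measurable_tnth i) (measurable_funPT Z')).
have mZn1 i : measurable_fun setT (fun w : Tn n * T => tnth (Zn n w.1) i).
  exact: (measurableT_comp (mZ _ _ _ (Zn n) i) measurable_fst).
have mZ2 i : measurable_fun setT (fun w : Tn n * T => tnth (Z w.2) i).
  exact: (measurableT_comp (mZ _ _ _ Z i) measurable_snd).
pose c1 : R := d%:R * s; pose c2 : R := d%:R * K.
have c1_ge0 : 0 <= c1 by rewrite mulr_ge0// ltW.
have c2_ge0 : 0 <= c2 by rewrite mulr_ge0// ltW.
pose ex1 (w : Tn n * T) := excess K (Zn n w.1).
pose ex2 (w : Tn n * T) := excess K (Z w.2).
have mexcess disp' (T' : measurableType disp') (P' : probability T' R)
    (Z' : {RV P' >-> d.-tuple R}) : measurable_fun setT (fun w => excess K (Z' w)).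
  exact: (measurableT_comp (measurable_excess K) (measurable_funPT Z')).
have mex1 : measurable_fun setT ex1.
  exact: (measurableT_comp (mexcess _ _ _ (Zn n)) measurable_fst).
have mex2 : measurable_fun setT ex2.
  exact: (measurableT_comp (mexcess _ _ _ Z) measurable_snd).
have cost_le w : l1norm (fun i => tnth (Zn n w.1) i - tnth (Z w.2) i) <=
    ex1 w + ex2 w + (c1 + c2 * \1_D w).
  have -> : c1 + c2 * \1_D w = \sum_(i < d) (s + K * \1_D w).
    by rewrite sumr_const card_ord -mulr_natl /c1 /c2; ring.
  rewrite /ex1 /ex2 /excess -!big_split/=; apply: ler_sum => i _.
  rewrite indicE; have [wD|wD] := boolP (w \in D).
    have := dist_le_of_nonneg N s0 (Zn0 w.1 i) (Z0 w.2 i).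
    by rewrite -/K mulr1; have := s0; lra.
  have same : grid_label N s (Zn n w.1) = grid_label N s (Z w.2).
    by move: wD; rewrite notin_setE => /contrapT.
  have := dist_le_of_same_cells (N := N) s0 (Zn0 w.1 i) (Z0 w.2 i).
  rewrite -/K => /(_ _)/le_trans; apply; last by rewrite mulr0; lra.
  move=> k kN; have /ffunP /(_ (i, Ordinal kN)) := same.
  by rewrite !ffunE.
have l1_ge0 w : 0 <= l1norm (fun i => tnth (Zn n w.1) i - tnth (Z w.2) i).
  exact: sumr_ge0.
have ex1E : (\int[pi]_w (ex1 w)%:E <= eta%:E)%E.
  rewrite (ge0_integral_law measurable_fst pi1 (mexcess _ _ _ (Zn n))) => [|w].
    by rewrite expected_excess// lee_fin ltW.
  exact: excess_ge0.
have ex2E : (\int[pi]_w (ex2 w)%:E <= eta%:E)%E.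
  rewrite (ge0_integral_law measurable_snd pi2 (mexcess _ _ _ Z)) => [|w].
    by rewrite expected_excess// lee_fin ltW.
  exact: excess_ge0.
apply: (@le_trans _ _ (\int[pi]_w ((ex1 w)%:E + (ex2 w)%:E +
    (c1%:E + c2%:E * (\1_D w)%:E)))%E).
  apply: ge0_le_integral => //.
  - by move=> w _; rewrite lee_fin.
  - apply/measurable_EFinP; apply: measurable_sum => i.
    by apply: measurableT_comp => //; exact: measurable_funB.
  - apply/measurable_EFinP; apply: measurable_funD; first exact: measurable_funD.
    by apply: measurable_funD => //; exact: measurable_funM.
  - by move=> w _; rewrite -EFinM -!EFinD lee_fin.
have ex1_ge0 w : (0 <= (ex1 w)%:E)%E by rewrite lee_fin excess_ge0.
have ex2_ge0 w : (0 <= (ex2 w)%:E)%E by rewrite lee_fin excess_ge0.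
have mc2 : measurable_fun setT (fun w => c2%:E * (\1_D w)%:E)%E.
  by apply/measurable_EFinP; exact: measurable_funM.
have c2D_ge0 w : (0 <= c2%:E * (\1_D w)%:E)%E by rewrite mule_ge0// lee_fin.
rewrite ge0_integralD//=; last 4 first.
- by move=> w _; exact: adde_ge0.
- by apply: emeasurable_funD; exact/measurable_EFinP.
- by move=> w _; rewrite adde_ge0// lee_fin.
- exact: emeasurable_funD.
rewrite ge0_integralD//=; [|exact/measurable_EFinP..].
rewrite ge0_integralD//=.
rewrite integral_cst// [X in (c1%:E * X)%E]probability_setT mule1.
rewrite ge0_integralZl//; [|exact/measurable_EFinP].
rewrite integral_indic// setIT.
apply: (@le_trans _ _ (eta%:E + eta%:E + (c1%:E + c2%:E * (1 - lam)%:E))%E).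
  apply: leeD; first exact: leeD.
  by apply: leeD => //; rewrite lee_wpmul2l// lee_fin.
rewrite -EFinM -!EFinD lee_fin.
have d0 : 0 <= d%:R :> R by [].
have c1_le : c1 <= d%:R * eta by rewrite ler_wpM2l// ltW.
have c2_le : c2 * (1 - lam) <= d%:R * eta by rewrite -mulrA ler_wpM2l.
have eE : e = 4 * (d%:R * eta) + 4 * eta.
  rewrite -mulrDr -[X in _ * (_ + X)]mul1r -mulrDl natr1 mulrA mulrC.
  by rewrite /eta mulfVK// mulf_neq0// pnatr_eq0.
have deta_ge0 := mulr_ge0 d0 (ltW eta0).
have sum_le (a b c x : R) : 0 <= a -> 0 < x -> b <= a -> c <= a ->
    x + x + (b + c) <= 4 * a + 4 * x by move=> *; lra.
by rewrite [leRHS]eE; exact: sum_le.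
Unshelve. all: by end_near. Qed.

End convergence_of_couplings.

(** * Reduction to nonnegative vectors, and the Lipschitz bound *)

Lemma measure_eq_on_full_set (R : realType) d (T : measurableType d)
    (P : {measure set T -> \bar R}) (G A B : set T) :
    measurable G -> measurable A -> measurable B -> P (~` G) = 0%E ->
    A `&` G = B `&` G ->
  P A = P B.
Proof.
move=> mG mA mB PG AB.
have E C : measurable C -> P C = P (C `&` G).
  move=> mC; rewrite (measureDI P mC mG).
  rewrite -[RHS]add0e; congr (_ + _)%E.
  apply: (subset_measure0 _ _ _ PG) => //; first exact: measurableD.
  exact: measurableC.
by rewrite (E A mA) AB -(E B mB).
Qed.

(** Take the coordinatewise positive parts.  The maximum with 1 does not see
    negative coordinates, so the max-characteristic function is literally
    unchanged; the laws agree because the change is almost surely void. *)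
Lemma exists_nonneg_version (R : realType) (d : nat) (disp : measure_display)
    (T : measurableType disp) (P : probability T R)
    (Z : {RV P >-> d.-tuple R}) : nonneg_integrable Z ->
  exists Z' : {RV P >-> d.-tuple R},
    [/\ forall w i, 0 <= tnth (Z' w) i,
        forall i, P.-integrable setT (fun w => (tnth (Z' w) i)%:E),
        forall x : d.-tuple R, (forall i, 0 <= tnth x i) ->
          max_cf Z' x = max_cf Z x &
        forall A, measurable A -> distribution P Z' A = distribution P Z A].
Proof.
move=> hZ.
have mZ i : measurable_fun setT (fun w => tnth (Z w) i).
  exact: (measurableT_comp (measurable_tnth i) (measurable_funPT Z)).
pose f w : d.-tuple R := [tuple Num.max 0 (tnth (Z w) i) | i < d].
have mf : measurable_fun setT f.
  apply/measurable_fun_tnthP => i.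
  rewrite (_ : _ \o _ = fun w => Num.max 0 (tnth (Z w) i)).
    exact: measurable_maxr.
  by apply/funext => w /=; rewrite tnth_mktuple.
pose Z' : {RV P >-> d.-tuple R} := HB.pack f (isMeasurableFun.Build _ _ _ _ _ mf).
exists Z'; split=> [w i|i|x x0|A mA].
- by rewrite tnth_mktuple le_max lexx.
- rewrite (_ : (fun w => _) = (fun w => (Num.max 0 (tnth (Z w) i))%:E)).
    by apply: integrable_max_cst; have [] := hZ i.
  by apply/funext => w; rewrite tnth_mktuple.
- rewrite !max_cfE; apply: eq_Rintegral => w _.
  suff [] : \big[Num.max/1]_(i < d) (tnth x i * tnth (Z' w) i) =
     \big[Num.max/1]_(i < d) (tnth x i * tnth (Z w) i) /\
     0 <= \big[Num.max/1]_(i < d) (tnth x i * tnth (Z w) i) by [].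
  elim/big_rec2: _ => [//|i a b _ [-> b0]]; split; last by rewrite le_max b0 orbT.
  by rewrite tnth_mktuple maxr_pMr// mulr0 -maxA maxCA (max_idPr b0).
- pose G := \bigcap_(i in [set: 'I_d]) [set w | 0 <= tnth (Z w) i].
  have mG : measurable G.
    apply: fin_bigcap_measurable => [|i _]; first exact: finite_finset.
    rewrite -[X in measurable X]setTI; exact: measurable_fun_le.
  apply: (measure_eq_on_full_set mG).
  + exact: (measurable_funPTI Z').
  + exact: (measurable_funPTI Z).
  + apply: measure_negligible; first exact: measurableC.
    have : {ae P, forall w, forall i, 0 <= tnth (Z w) i}.
      by apply: filter_forall => i; have [] := hZ i.
    by apply: negligibleS => w /= nG all0; apply: nG => i _; exact: all0.
  + have E w : G w -> f w = Z w.
      move=> Gw; apply: eq_from_tnth => i; rewrite tnth_mktuple.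
      by apply/max_idPr; exact: Gw.
    apply/seteqP; split=> w [Aw Gw]; split=> //; move: Aw; rewrite /= E//.
Qed.

Lemma bigmaxr_dist_le (R : realDomainType) (I : Type) (r : seq I) (a : R)
    (F G : I -> R) :
  `|\big[Num.max/a]_(i <- r) F i - \big[Num.max/a]_(i <- r) G i| <=
  \sum_(i <- r) `|F i - G i|.
Proof.
elim: r => [|i r IHr]; first by rewrite !big_nil subrr normr0.
rewrite !big_cons; apply: le_trans (lerD (lexx _) IHr).
move: (F i) (G i) (\big[_/_]_(_ <- _) F _) (\big[_/_]_(_ <- _) G _) => b b' c c'.
rewrite ler_norml !maxEle; case: (leP b c); case: (leP b' c');
  case: (ger0P (b - b')); case: (ger0P (c - c')) => *; apply/andP; split; lra.
Qed.

(** Both values are expectations over the space of the coupling, where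
    |V_x(X) - V_x(Y)| <= sum_i x_i |X_i - Y_i|. *)
Lemma max_cf_lipschitz (R : realType) (d : nat) d1 (T1 : measurableType d1)
    (P1 : probability T1 R) (Z1 : {RV P1 >-> d.-tuple R})
    d2 (T2 : measurableType d2) (P2 : probability T2 R)
    (Z2 : {RV P2 >-> d.-tuple R})
    d3 (Q3 : measurableType d3) (Q : probability Q3 R)
    (X Y : {RV Q >-> d.-tuple R}) (x : d.-tuple R) (e : R) :
    (forall i, P1.-integrable setT (fun w => (tnth (Z1 w) i)%:E)) ->
    (forall i, P2.-integrable setT (fun w => (tnth (Z2 w) i)%:E)) ->
    has_law X (distribution P1 Z1) -> has_law Y (distribution P2 Z2) ->
    (forall i, 0 <= tnth x i) ->
    (\int[Q]_w (l1norm (fun i => (tnth (X w) i - tnth (Y w) i)%R))%:E <= e%:E)%E ->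
  `|max_cf Z1 x - max_cf Z2 x| <= (\sum_(i < d) tnth x i) * e.
Proof.
move=> iZ1 iZ2 lawX lawY x0 cost_le.
pose V (z : d.-tuple R) := \big[Num.max/1]_(i < d) (tnth x i * tnth z i).
have V0 z : 0 <= V z by apply: le_trans (bigmax_ge_id _ _ _ _).
have mV : measurable_fun setT V.
  rewrite /V; elim: (index_enum _) => [|i r IH].
    under eq_fun do rewrite big_nil.
    exact: measurable_cst.
  under eq_fun do rewrite big_cons.
  apply: measurable_maxr => //; apply: measurable_funM => //.
  exact: measurable_tnth.
have lawE d' (T' : measurableType d') (P' : probability T' R)
    (Z' : {RV P' >-> d.-tuple R}) (X' : {RV Q >-> d.-tuple R}) :
    (forall i, P'.-integrable setT (fun w => (tnth (Z' w) i)%:E)) ->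
    has_law X' (distribution P' Z') ->
    Q.-integrable setT (EFin \o (V \o X')) /\ max_cf Z' x = \int[Q]_w V (X' w).
  move=> iZ' law.
  have E : (\int[Q]_w (V (X' w))%:E = \int[P']_w (V (Z' w))%:E)%E.
    rewrite (ge0_integral_law (measurable_funPT X') law mV V0).
    rewrite ge0_integral_distribution//; exact/measurable_EFinP.
  split; last by rewrite max_cfE /Rintegral -E.
  have mVX' : measurable_fun setT (V \o X').
    exact: (measurableT_comp mV (measurable_funPT X')).
  apply/integrableP; split; first exact/measurable_EFinP.
  under eq_integral do rewrite /= ger0_norm//.
  rewrite E; have /integrableP[_] := integrable_bigmax_coord iZ' 1 x.
  apply: le_lt_trans; rewrite le_eqVlt; apply/orP; left; apply/eqP.
  by apply: eq_integral => w _; rewrite /= ger0_norm// (V0 (Z' w)).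
have [iVX ->] := lawE _ _ _ _ _ iZ1 lawX.
have [iVY ->] := lawE _ _ _ _ _ iZ2 lawY.
have mcoord (X' : {RV Q >-> d.-tuple R}) i :
    measurable_fun setT (fun w => tnth (X' w) i).
  exact: (measurableT_comp (measurable_tnth i) (measurable_funPT X')).
pose cost w := l1norm (fun i => tnth (X w) i - tnth (Y w) i).
have cost0 w : 0 <= cost w by exact: sumr_ge0.
have mcost : measurable_fun setT cost.
  apply: measurable_sum => i.
  by apply: measurableT_comp => //; exact: measurable_funB.
have icost : Q.-integrable setT (EFin \o cost).
  apply/integrableP; split; first exact/measurable_EFinP.
  under eq_integral do rewrite /= ger0_norm//.
  exact: le_lt_trans cost_le (ltry _).
pose L := \sum_(i < d) tnth x i.
have L0 : 0 <= L by exact: sumr_ge0.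
have V_le w : `|V (X w) - V (Y w)| <= L * cost w.
  apply: le_trans (bigmaxr_dist_le _ _ _ _) _.
  rewrite /cost /l1norm mulr_sumr; apply: ler_sum => i _.
  rewrite -mulrBr normrM ger0_norm// ler_wpM2r//.
  by rewrite /L (bigD1 i)//= lerDl sumr_ge0.
have iB : Q.-integrable setT (EFin \o (fun w => V (X w) - V (Y w))).
  exact: (integrableB measurableT iVX iVY).
rewrite -RintegralB//.
apply: le_trans (le_normr_Rintegral measurableT iB) _.
apply: (@le_trans _ _ (\int[Q]_w (L * cost w))).
  apply: le_Rintegral => //; first exact: (integrable_norm iB).
  exact: (integrableZl measurableT L icost).
rewrite RintegralZl// ler_wpM2l//.
rewrite -lee_fin /Rintegral fineK//.
exact: integrable_fin_num.
Qed.

Theorem theorem2p1 (R : realType) (d : nat)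
    (disp : measure_display) (T : measurableType disp) (P : probability T R)
    (Z : {RV P >-> d.-tuple R})
    (dispn : nat -> measure_display) (Tn : forall n, measurableType (dispn n))
    (Pn : forall n, probability (Tn n) R)
    (Zn : forall n, {RV (Pn n) >-> d.-tuple R})
    (hZ : nonneg_integrable Z)
    (hZn : forall n, nonneg_integrable (Zn n)) :
  (forall x : d.-tuple R, (forall i, 0 <= tnth x i) ->
     max_cf (Zn n) x @[n --> \oo] --> max_cf Z x) <->
  wasserstein (distribution (Pn n) (Zn n)) (distribution P Z) @[n --> \oo]
    --> 0%E.
Proof.
split=> [cvg_phi|cvg_W x x0].
- have [Z' [Z'0 iZ' cfZ' lawZ']] := exists_nonneg_version hZ.
  pose Zn' n := sval (cid (exists_nonneg_version (hZn n))).
  have Zn'P n := svalP (cid (exists_nonneg_version (hZn n))).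
  have Zn'0 n w i : 0 <= tnth (Zn' n w) i by have [] := Zn'P n.
  have iZn' n i : (Pn n).-integrable setT (fun w => (tnth (Zn' n w) i)%:E).
    by have [] := Zn'P n.
  have lawZn' n A : measurable A ->
      distribution (Pn n) (Zn' n) A = distribution (Pn n) (Zn n) A.
    by have [_ _ _] := Zn'P n; exact.
  have cvg_phi' x : (forall i, 0 <= tnth x i) ->
      max_cf (Zn' n) x @[n --> \oo] --> max_cf Z' x.
    move=> x0; rewrite cfZ'//; apply: cvg_trans (cvg_phi x x0).
    apply: near_eq_cvg; near=> n.
    by have [_ _ cfZn' _] := Zn'P n; rewrite cfZn'.
  have W_small e : 0 < e -> \forall n \near \oo,
      (0 <= wasserstein (distribution (Pn n) (Zn n)) (distribution P Z) <= e%:E)%E.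
    move=> e0; have := eventually_cheap_coupling iZ' iZn' Z'0 Zn'0 cvg_phi' e0.
    apply: filterS => n [pi [pi1 pi2 cost_le]]; apply/andP; split.
      apply: le_ereal_inf_tmp => c [d3 [T3 [Q [X [Y [_ _ ->]]]]]].
      rewrite unlock; apply: integral_ge0 => w _.
      by rewrite lee_fin; exact: sumr_ge0.
    have mX : measurable_fun setT (Zn' n \o fst : Tn n * T -> d.-tuple R).
      exact: (measurableT_comp (measurable_funPT (Zn' n)) measurable_fst).
    have mY : measurable_fun setT (Z' \o snd : Tn n * T -> d.-tuple R).
      exact: (measurableT_comp (measurable_funPT Z') measurable_snd).
    pose X : {RV pi >-> d.-tuple R} :=
      HB.pack (Zn' n \o fst) (isMeasurableFun.Build _ _ _ _ _ mX).
    pose Y : {RV pi >-> d.-tuple R} :=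
      HB.pack (Z' \o snd) (isMeasurableFun.Build _ _ _ _ _ mY).
    apply: ge_ereal_inf; eexists; last exact: cost_le.
    exists _, (Tn n * T)%type, pi, X, Y; split; last by rewrite unlock.
      move=> A mA; apply: etrans (lawZn' n A mA).
      by apply: (pi1 (Zn' n @^-1` A)); exact: (measurable_funPTI (Zn' n)).
    move=> A mA; apply: etrans (lawZ' A mA).
    by apply: (pi2 (Z' @^-1` A)); exact: (measurable_funPTI Z').
  apply/fine_cvgP; split.
    apply: filterS (W_small 1 ltr01) => n /andP[W0 W1].
    by rewrite ge0_fin_numE// (le_lt_trans W1)// ltry.
  apply/cvgrPdist_le => e e0; apply: filterS (W_small e e0) => n /andP[W0 We].
  rewrite sub0r normrN ger0_norm ?fine_ge0//=.
  rewrite -lee_fin fineK//.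
  by rewrite ge0_fin_numE// (le_lt_trans We)// ltry.
- have iZ i : P.-integrable setT (fun w => (tnth (Z w) i)%:E) by have [] := hZ i.
  have iZn n i : (Pn n).-integrable setT (fun w => (tnth (Zn n w) i)%:E).
    by have [] := hZn n i.
  pose L := \sum_(i < d) tnth x i.
  have L1 : 0 < L + 1 by rewrite ltr_wpDl// sumr_ge0.
  apply/cvgrPdist_lt => e e0.
  have [W_fin /cvgrPdist_lt/(_ (e / (L + 1)))] := (fine_cvgP _ _).1 cvg_W.
  rewrite divr_gt0// => /(_ isT) W_small.
  near=> n.
  have : (wasserstein (distribution (Pn n) (Zn n)) (distribution P Z) <
      (e / (L + 1))%:E)%E.
    have fin : wasserstein (distribution (Pn n) (Zn n)) (distribution P Z)
      \is a fin_num by near: n.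
    rewrite -(fineK fin) lte_fin.
    have : `|0 - fine (wasserstein (distribution (Pn n) (Zn n))
      (distribution P Z))| < e / (L + 1) by near: n.
    by rewrite sub0r normrN; apply: le_lt_trans; exact: ler_norm.
  move=> /ereal_inf_lt[c [disp' [T' [Q [X [Y [lawX lawY ->]]]]]]].
  rewrite unlock => cost_lt; rewrite distrC.
  apply: le_lt_trans (max_cf_lipschitz (iZn n) iZ lawX lawY x0 (ltW cost_lt)) _.
  by rewrite mulrCA -[ltRHS]mulr1 ltr_pM2l// ltr_pdivrMr// mul1r ltrDl.
Unshelve. all: by end_near. Qed.
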